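(* Let $n\in\mathbb{Z}_{>1}$ and $G_n=\bigoplus_{j=1}^\infty\mathbb{Z}/n\mathbb{Z}$. The function $\mathbb{L}_n:G_n\to[0,\infty)$ given by $$\mathbb{L}_n\left((m_j)_{j=1}^\infty\right)=\sum_{j=1}^\infty\left|\exp\left(\frac{2\pi i m_j}{n}\right)-1\right|n^j$$ is of bounded doubling with constant $C_{\mathbb{L}_n}=n^{4(1+\log_n(2))}$.
   Context: A length function on a group $G$ is a map $\mathbb{L}:G\to[0,\infty)$ such that $\mathbb{L}(x)=0$ if and only if $x$ is the identity, $\mathbb{L}(xy)\le\mathbb{L}(x)+\mathbb{L}(y)$, and $\mathbb{L}(x^{-1})=\mathbb{L}(x)$ for all $x,y\in G$. It is proper if $B_{\mathbb{L}}(r)=\{x\in G:\mathbb{L}(x)\le r\}$ is finite for every $r\ge0$. A proper length function is of bounded doubling with constant $C_{\mathbb{L}}<\infty$ if $\mathrm{card}(B_{\mathbb{L}}(2r))\le C_{\mathbb{L}}\,\mathrm{card}(B_{\mathbb{L}}(r))$ for all real $r\ge1$. Elements of the direct sum have finitely many nonzero coordinates, so the sum defining $\mathbb{L}_n$ is finite. *)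

(* Defs.v *)
From HB Require Import structures.
From mathcomp Require Import all_boot all_order all_algebra all_fingroup.
From mathcomp Require Import finmap complex.
From mathcomp Require Import all_classical all_reals all_analysis.

Set Implicit Arguments.
Unset Strict Implicit.
Unset Printing Implicit Defensive.

Import Order.TTheory GRing.Theory Num.Theory.

Local Open Scope fset_scope.
Local Open Scope classical_set_scope.
Local Open Scope ring_scope.

Section LengthFunctions.
Context {R : realType} {G : groupType}.

Definition is_length_function (L : G -> R) : Prop :=
  [/\ forall x, 0 <= L x,
      forall x, L x = 0 <-> x = 1%g,
      forall x y, L (x * y)%g <= L x + L y
    & forall x, L (x^-1)%g = L x].

Definition length_ball (L : G -> R) (r : R) : set G := [set x | L x <= r].

Definition is_proper (L : G -> R) : Prop :=
  forall r, 0 <= r -> finite_set (length_ball L r).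

(* fset_set A is the finite set A when A is finite, which is_proper ensures
   here, and is empty otherwise. *)
Definition length_ball_card (L : G -> R) (r : R) : nat :=
  #|` fset_set (length_ball L r)|.

Definition bounded_doubling (L : G -> R) (C : R) : Prop :=
  [/\ is_length_function L, is_proper L
    & forall r, 1 <= r ->
        (length_ball_card L (2 * r))%:R <= C * (length_ball_card L r)%:R].

End LengthFunctions.

Record direct_sum (I : Type) (G : groupType) := DirectSum {
  dsum_coord :> I -> G;
  dsum_finite_support : finite_set [set i | dsum_coord i <> 1%g] }.

HB.instance Definition _ (I : Type) (G : groupType) :=
  gen_eqMixin (direct_sum I G).
HB.instance Definition _ (I : Type) (G : groupType) :=
  gen_choiceMixin (direct_sum I G).

Section DirectSumGroup.
Context {I : Type} {G : groupType}.
Local Notation D := (direct_sum I G).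
Implicit Types x y z : D.

Lemma dsum_ext x y : (forall i, x i = y i) -> x = y.
Proof.
case: x y => [f hf] [g hg] /= /funext fg; move: hg; rewrite -fg => hg.
by rewrite (Prop_irrelevance hf hg).
Qed.

Lemma dsum_one_subproof : finite_set [set i : I | (1%g : G) <> 1%g].
Proof. by apply: (sub_finite_set _ (finite_set0 I)) => i /=. Qed.

Lemma dsum_inv_subproof x : finite_set [set i | (x i)^-1%g <> 1%g].
Proof.
apply: (sub_finite_set _ (dsum_finite_support x)) => i /= xi1 xi.
by apply: xi1; rewrite xi invg1.
Qed.

Lemma dsum_mul_subproof x y : finite_set [set i | (x i * y i)%g <> 1%g].
Proof.
have fin : finite_set ([set i | x i <> 1%g] `|` [set i | y i <> 1%g]).
  by rewrite finite_setU; split; exact: dsum_finite_support.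
apply: (sub_finite_set _ fin) => i /= xyi.
have [xi|xi] := eqVneq (x i) 1%g; last by left; apply/eqP.
by right => yi; apply: xyi; rewrite xi yi mulg1.
Qed.

Definition dsum_one : D := DirectSum dsum_one_subproof.
Definition dsum_inv x : D := DirectSum (dsum_inv_subproof x).
Definition dsum_mul x y : D := DirectSum (dsum_mul_subproof x y).

Lemma dsum_mulgA : associative dsum_mul.
Proof. by move=> x y z; apply: dsum_ext => i /=; rewrite mulgA. Qed.
Lemma dsum_mul1g : left_id dsum_one dsum_mul.
Proof. by move=> x; apply: dsum_ext => i /=; rewrite mul1g. Qed.
Lemma dsum_mulg1 : right_id dsum_one dsum_mul.
Proof. by move=> x; apply: dsum_ext => i /=; rewrite mulg1. Qed.
Lemma dsum_mulVg : left_inverse dsum_one dsum_inv dsum_mul.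
Proof. by move=> x; apply: dsum_ext => i /=; rewrite mulVg. Qed.
Lemma dsum_mulgV : right_inverse dsum_one dsum_inv dsum_mul.
Proof. by move=> x; apply: dsum_ext => i /=; rewrite mulgV. Qed.

HB.instance Definition _ := isGroup.Build D
  dsum_mulgA dsum_mul1g dsum_mulg1 dsum_mulVg dsum_mulgV.

End DirectSumGroup.

Definition cexp {R : realType} (z : R[i]) : R[i] :=
  let: Complex a b := z in Complex (expR a * cos b) (expR a * sin b).

(* 'Z_n is written multiplicatively here: its groupType law is addition mod n.
   It is Z/nZ only for 1 < n. *)
Definition G_ (n : nat) : groupType := direct_sum nat 'Z_n.

(* The coordinate m j is the informal m_(j+1), since nat starts at 0: hence the
   weight n ^+ j.+1. The sum has finite support. *)
Definition L_ {R : realType} (n : nat) (m : G_ n) : R :=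
  \sum_(j \in [set: nat])
    Normc.normc (cexp ((2 * (pi : R) * (m j : nat)%:R / n%:R) *i)%C - 1)
      * n%:R ^+ j.+1.

Arguments L_ {R} n m.

(* Main.v *)
(* The weight |exp(2 pi i a / n) - 1| equals 2 |sin(pi a / n)|, which lies in
   [4/n, 2] for a != 0 by Jordan's inequality. Let S_k be the subgroup of the n^k
   elements supported on the first k coordinates. The lower bound gives
   B(r) <= S_k as soon as r < 4 n^k, the upper bound gives L < 4 n^k on S_k.
   With k least such that r < 2 n^k, it follows that
   S_(max(k-2,0)) <= B(r) <= B(2r) <= S_k, so the cardinality grows by a factor
   at most n^2, while n^(4 (1 + log_n 2)) = (2n)^4. *)

Require Import Defs.
From mathcomp Require Import all_boot all_order all_algebra all_fingroup.
From mathcomp Require Import all_classical all_reals all_analysis.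
From mathcomp Require Import finmap complex ring lra.

Set Implicit Arguments.
Unset Strict Implicit.
Unset Printing Implicit Defensive.

Import Order.TTheory GRing.Theory Num.Theory.
Import numFieldNormedType.Exports.
Local Open Scope ring_scope.

(** * Trigonometric estimates *)

Lemma jordan_ineq (R : realType) (x : R) :
  0 <= x <= pi / 2 -> x <= sin x * (pi / 2).
Proof.
move=> /andP[x0 xpi].
have pi0 := @pi_gt0 R.
have dsin y : is_derive (y : R) (1 : R) (@sin R) (cos y).
  exact: is_derive_sin.
have csin a b : {within `[a, b], continuous (@sin R)}%classic.
  by apply: continuous_subspaceT => y; exact: continuous_sin.
have [c + E1] := MVT_segment x0 (fun y _ => dsin y) (csin 0 x).
have [d + E2] := MVT_segment xpi (fun y _ => dsin y) (csin x (pi / 2)).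
rewrite !in_itv /= => /andP[xd dpi] /andP[c0 cx].
have cosdc : cos d <= cos c.
  rewrite leNgt ltr_cos ?in_itv /=; [|lra|lra].
  by rewrite -leNgt; lra.
(* c <= x <= d: the slope of sin on [0, x] is at least its slope on [x, pi/2]. *)
move: E1 E2; rewrite sin0 sin_pihalf !subr0 => E1 E2.
(* Multiplied out, this product is sin x * (pi / 2) - x, because cos c * x = sin x and cos d * (pi /
   2 - x) = 1 - sin x. *)
have H : 0 <= (cos c - cos d) * (x * (pi / 2 - x)).
  by rewrite !mulr_ge0 ?subr_ge0.
rewrite mulrBl [X in X - _]mulrA -E1 mulrCA -E2 in H.
lra.
Qed.

Lemma normc_cexp_sub1 (R : realType) (t : R) :
  Normc.normc (cexp (t *i)%C - 1) = 2 * `|sin (t / 2)|.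
Proof.
rewrite /cexp /= expR0 !mul1r.
have -> : t = (t / 2) *+ 2 by rewrite -mulr_natr; field.
rewrite (_ : t / 2 *+ 2 / 2 = t / 2); last by rewrite -mulr_natr; field.
set u := t / 2.
rewrite cos_mulr2n sin_mulr2n oppr0 addr0.
rewrite (_ : _ + _ = (2 * sin u) ^+ 2); last first.
  transitivity (4 * (cos u ^+ 2 - 1) ^+ 2 + 4 * cos u ^+ 2 * sin u ^+ 2).
    by ring.
  by rewrite exprMn sin2cos2; ring.
by rewrite sqrtr_sqr normrM ger0_norm.
Qed.

(** Addition formula with both cosines bounded by 1; it becomes the triangle inequality for
    [chord]. *)
Lemma norm_sinD_le (R : realType) (x y : R) :
  `|sin (x + y)| <= `|sin x| + `|sin y|.
Proof.
rewrite sinD (le_trans (ler_normD _ _))// !normrM lerD//.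
  by rewrite ler_piMr// cos_max.
by rewrite ler_piMl// cos_max.
Qed.

Lemma norm_sinD_natpi (R : realType) (x : R) k :
  `|sin (x + pi *+ k)| = `|sin x|.
Proof.
elim: k => [|k IH]; first by rewrite mulr0n addr0.
by rewrite mulrSr addrA sinDpi normrN.
Qed.

(** * Chord lengths of the n-th roots of unity *)

(** Half-angle form of |exp(2 pi i a / n) - 1|. *)
Definition chord {R : realType} (n : nat) (a : 'Z_n) : R :=
  2 * `|sin (pi * a%:R / n%:R)|.

Section Chord.
Context {R : realType} {n : nat} (n_gt1 : (1 < n)%N).
Local Notation chord := (@chord R n).
Implicit Types a b : 'Z_n.

Let n_neq0 : n%:R != 0 :> R.
Proof. by rewrite pnatr_eq0 -lt0n (ltnW n_gt1). Qed.

Lemma normc_root_sub1 a :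
  Normc.normc (cexp ((2 * (pi : R) * a%:R / n%:R) *i)%C - 1) = chord a.
Proof. by rewrite normc_cexp_sub1 /chord; do 3!congr (_ _); field. Qed.

(** Reduction mod n shifts the angle by a multiple of pi, which leaves |sin| unchanged. *)
Lemma norm_sin_modn k :
  `|sin (pi * (k %% n)%:R / n%:R)| = `|sin (pi * k%:R / n%:R)| :> R.
Proof.
rewrite [in RHS](divn_eq k n) -(norm_sinD_natpi _ (k %/ n)%N).
congr (`|sin _|); rewrite natrD natrM -mulr_natr.
by field.
Qed.

Lemma chord_ge0 a : 0 <= chord a.
Proof. by rewrite mulr_ge0. Qed.

Lemma chord_le2 a : chord a <= 2.
Proof. by rewrite ler_piMr// sin_max. Qed.

Lemma chord1 : chord 1%g = 0.
Proof. by rewrite /chord mulr0 mul0r sin0 normr0 mulr0. Qed.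

Lemma ltn_Zn a : (a < n)%N.
Proof. exact: leq_trans (ltn_ord a) (eq_leq (Zp_cast n_gt1)). Qed.

Lemma chordM_le a b : chord (a * b)%g <= chord a + chord b.
Proof.
(* The modulus built into ['Z_n] is [(Zp_trunc n).+2]; [Zp_cast] identifies it with n. *)
have abE : (a * b)%g = ((a + b) %% n)%N :> nat.
  by rewrite -[RHS](congr1 (modn (a + b)%N) (Zp_cast n_gt1)).
rewrite -mulrDr ler_pM2l// abE norm_sin_modn natrD mulrDr mulrDl.
exact: norm_sinD_le.
Qed.

Lemma chordV a : chord a^-1%g = chord a.
Proof.
have aVE : a^-1%g = ((n - a) %% n)%N :> nat.
  by rewrite -[RHS](congr1 (fun p => (p - a) %% p)%N (Zp_cast n_gt1)).
rewrite /chord aVE norm_sin_modn; congr (_ * _).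
have an := ltnW (ltn_Zn a).
(* Passing from a to n - a turns the angle x into pi - x. *)
rewrite natrB// -[RHS]normrN -sinN -[RHS](norm_sinD_natpi _ 1).
by congr (`|sin _|); rewrite mulr1n; field.
Qed.

Lemma chord_ge a : a != 1%g -> 4 / n%:R <= chord a.
Proof.
move=> a1; have a_gt0 : (0 < a)%N by rewrite lt0n.
have an := ltn_Zn a.
have n0 : 0 < n%:R :> R by rewrite ltr0n (ltnW n_gt1).
have key k : (0 < k)%N -> (2 * k <= n)%N ->
    2 / n%:R <= `|sin (pi * k%:R / n%:R)| :> R.
  move=> k0 kn; rewrite (le_trans _ (ler_norm _))//.
  have pi0 := @pi_gt0 R.
  have kn' : 2 * k%:R <= n%:R :> R by rewrite -natrM ler_nat.
  have k1 : 1 <= k%:R :> R by rewrite ler1n.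
  have x0 : 0 <= pi * k%:R / n%:R :> R by rewrite divr_ge0 ?mulr_ge0// pi_ge0.
  have xpi : pi * k%:R / n%:R <= pi / 2 :> R.
    by rewrite ler_pdivrMr// mulrAC ler_pdivlMr// -mulrA ler_pM2l// mulrC.
  have := @jordan_ineq R (pi * k%:R / n%:R); rewrite x0 xpi => /(_ isT).
  have : 0 <= pi * n%:R^-1 * (k%:R - 1) :> R.
    by rewrite !mulr_ge0 ?subr_ge0 ?pi_ge0.
  by move=> k1n xle; rewrite -(ler_pM2r pi0); lra.
rewrite /chord (_ : 4 / n%:R = 2 * (2 / n%:R)) ?ler_pM2l//; last by field.
(* Beyond n / 2, n - a replaces a: the sine is the same and [key] applies. *)
have [an2|an2] := leqP (2 * a) n; first exact: key.
have := key (n - a)%N; rewrite subn_gt0 => /(_ an).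
rewrite (natrB _ (ltnW an)).
have -> : pi * (n%:R - a%:R) / n%:R = - (pi * a%:R / n%:R) + pi *+ 1 :> R.
  by rewrite mulr1n; field.
rewrite norm_sinD_natpi sinN normrN; apply.
by rewrite mulnBr leq_subLR mulSn mul1n leq_add2r ltnW.
Qed.

End Chord.

(** * The subgroups S_k: finiteness and order *)

Definition supported {n : nat} (k : nat) : set (G_ n) :=
  [set m | forall j, (k <= j)%N -> m j = 1%g].

Lemma ex_supported n (m : G_ n) : exists k, supported k m.
Proof.
have /finite_seqP[s sE] := dsum_finite_support m.
exists (\max_(i <- s) i).+1 => j jk; apply/eqP/negPn/negP => /eqP mj.
have : j \in s by have : [set` s]%classic j by rewrite -sE.
by move=> /leq_bigmax_seq => /(_ xpredT id isT); rewrite leqNgt jk.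
Qed.

Lemma supportedS n j k : (j <= k)%N ->
  (@supported n j `<=` supported k)%classic.
Proof. by move=> jk m mj i ki; apply: mj; exact: leq_trans ki. Qed.

Section Extension.
Context {n : nat} (k : nat).

(** For j >= k, [insub j] is [None], and the default [1%g] pads the tuple. *)
Definition ffun_extend (f : {ffun 'I_k -> 'Z_n}) (j : nat) : 'Z_n :=
  oapp f 1%g (insub j).

Lemma ffun_extend_finite_support f :
  finite_set [set j | ffun_extend f j <> 1%g]%classic.
Proof.
apply: sub_finite_set (finite_II k) => j /=; rewrite /ffun_extend.
by case: insubP => //= i; rewrite mem_setE.
Qed.

Definition dsum_of_ffun f : G_ n := DirectSum (ffun_extend_finite_support f).

Lemma dsum_of_ffun_inj : injective dsum_of_ffun.
Proof.
move=> f g fg; apply/ffunP => i.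
have := congr1 (fun m : G_ n => m i) fg.
by rewrite /= /ffun_extend !valK.
Qed.

(** Together with injectivity of [dsum_of_ffun], this gives both the finiteness of S_k and its order
    n^k. *)
Lemma supportedE :
  @supported n k =
  [set` [fset dsum_of_ffun f | f : {ffun 'I_k -> 'Z_n}]%fset]%classic.
Proof.
apply/seteqP; split=> m /= => [mk|/imfsetP[f _ ->] j kj].
  apply/imfsetP; exists [ffun i => m (val i)] => //; apply: dsum_ext => j /=.
  rewrite /ffun_extend; case: insubP => [i _ <-|] /=; first by rewrite ffunE.
  by rewrite -leqNgt => /mk.
by rewrite /= /ffun_extend insubN// -leqNgt.
Qed.

Lemma supported_finite : finite_set (@supported n k).
Proof. by rewrite supportedE; exact: finite_fset. Qed.

Lemma card_supported : (1 < n)%N -> #|` fset_set (@supported n k)| = (n ^ k)%N.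
Proof.
move=> n_gt1; rewrite supportedE set_fsetK.
rewrite card_imfset /=; last exact: dsum_of_ffun_inj.
by rewrite -cardE card_ffun !card_ord Zp_cast.
Qed.

End Extension.

(** * The length function and its balls *)

Section Length.
Context {R : realType} {n : nat} (n_gt1 : (1 < n)%N).
Local Notation chord := (@chord R n).
Implicit Types m : G_ n.

(** From index k on, the coordinates are trivial and their [chord] vanishes, so an ordinary finite
    sum remains. *)
Lemma L_supported k m : supported k m ->
  L_ n m = \sum_(j < k) chord (m j) * n%:R ^+ j.+1.
Proof.
move=> mk; rewrite (fsbig_ord _ k (fun j => chord (m j) * n%:R ^+ j.+1)).
transitivity (\sum_(j \in [set: nat]) chord (m j) * n%:R ^+ j.+1).
  by apply: eq_fsbigr => j _; congr (_ * _); exact: normc_root_sub1.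
apply/esym/fsbig_widen => // j [_ /= /negP]; rewrite -leqNgt => /mk ->.
by rewrite chord1 mul0r.
Qed.

Lemma L_ge_coord m j : chord (m j) * n%:R ^+ j.+1 <= L_ n m.
Proof.
have [k mk] := ex_supported m.
have mkj := supportedS (leq_maxl k j.+1) mk.
rewrite (L_supported mkj) (bigD1 (Ordinal (leq_maxr k j.+1)))//= lerDl.
by apply: sumr_ge0 => i _; rewrite mulr_ge0 ?chord_ge0 ?exprn_ge0.
Qed.

Lemma L_ge m j : m j != 1%g -> 4 * n%:R ^+ j <= L_ n m :> R.
Proof.
move=> mj; apply: le_trans (L_ge_coord m j).
rewrite exprS mulrA ler_pM2r ?exprn_gt0 ?ltr0n 1?ltnW//.
by rewrite -ler_pdivrMr ?ltr0n 1?ltnW// chord_ge.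
Qed.

(** Coordinate k adds at most 2 n^(k+1), and 4 n^k <= 2 n^(k+1) closes the induction. The -1 makes
    the bound 0 at k = 0, which is used for doubling at small r. *)
Lemma L_le k m : supported k m -> L_ n m <= 4 * (n%:R ^+ k - 1) :> R.
Proof.
move=> /L_supported ->.
have n2 : 2 <= n%:R :> R by rewrite ler_nat.
elim: k => [|k IH]; first by rewrite big_ord0 expr0 subrr mulr0.
rewrite big_ord_recr /=.
have c2 := @chord_le2 R n (m k).
have c0 := @chord_ge0 R n (m k).
have nk : 0 <= n%:R ^+ k :> R by rewrite exprn_ge0.
apply: le_trans (lerD IH (ler_wpM2r _ c2)) _; first exact: exprn_ge0.
by rewrite exprS; nra.
Qed.

(** A nontrivial coordinate at some j >= k would force a length of at least 4 n^j >= 4 n^k > r. *)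
Lemma length_ball_sub k (r : R) : r < 4 * n%:R ^+ k ->
  (length_ball (L_ n) r `<=` @supported n k)%classic.
Proof.
move=> rk m /= mr j kj; apply/eqP/negPn/negP => /L_ge mj.
have := le_lt_trans (le_trans mj mr) rk; apply/negP; rewrite -leNgt.
by rewrite ler_pM2l// ler_eXn2l// ltr1n.
Qed.

Lemma ex_expn_gt (r : R) : exists k, r < n%:R ^+ k.
Proof.
exists (Num.truncn r).+1; apply: lt_le_trans (truncnS_gt r) _.
by rewrite -natrX ler_nat ltnW// ltn_expl.
Qed.

Lemma L_length : is_length_function (@L_ R n).
Proof.
split=> [m|m|x y|x].
- exact: le_trans (mulr_ge0 (chord_ge0 _) (exprn_ge0 _ _)) (L_ge_coord m 0).
- split=> [m0|->]; last by rewrite (@L_supported 0) ?big_ord0.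
  apply: dsum_ext => j; apply/eqP/negPn/negP => /L_ge; rewrite m0 leNgt.
  by rewrite mulr_gt0 ?exprn_gt0 ?ltr0n 1?ltnW.
- have [k xk] := ex_supported x; have [l yl] := ex_supported y.
  (* A common support bound puts the three sums over the same indices. *)
  have {}xk := supportedS (leq_maxl k l) xk.
  have {}yl := supportedS (leq_maxr k l) yl.
  have xy : supported (maxn k l) (x * y)%g.
    by move=> j kj /=; rewrite xk// yl// mulg1.
  rewrite !(@L_supported (maxn k l))// -big_split; apply: ler_sum => j _ /=.
  by rewrite -mulrDl ler_wpM2r ?exprn_ge0// chordM_le.
- have [k xk] := ex_supported x.
  have xV : supported k (x^-1)%g by move=> j kj /=; rewrite xk// invg1.
  rewrite !(@L_supported k)//; apply: eq_bigr => j _ /=.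
  by rewrite chordV.
Qed.

Lemma L_proper : is_proper (@L_ R n).
Proof.
move=> r r0; have [k rk] := ex_expn_gt r.
apply: sub_finite_set (supported_finite k); apply: length_ball_sub.
by apply: lt_le_trans rk _; rewrite ler_peMl ?exprn_ge0// ler1n.
Qed.

Lemma L_doubling (r : R) : 0 <= r ->
  (length_ball_card (L_ n) (2 * r) <= n ^ 2 * length_ball_card (L_ n) r)%N.
Proof.
(* The threshold is chosen so that 2r < 4 n^k, which places B(2r) in S_k. *)
move=> r0; pose P k := r < 2 * n%:R ^+ k.
have exP : exists k, P k.
  have [k rk] := ex_expn_gt r; exists k; apply: lt_le_trans rk _.
  by rewrite ler_peMl ?exprn_ge0// ler1n.
case: (ex_minnP exP) => k Pk kmin.
have ball2 : (length_ball (L_ n) (2 * r) `<=` @supported n k)%classic.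
  by apply: length_ball_sub; move: Pk; rewrite /P; lra.
(* For k < 2, truncated subtraction gives S_0, of length 0 <= r. Otherwise minimality of k gives 2
   n^(k-1) <= r, and 4 n^(k-2) <= 2 n^(k-1). *)
have ball1 : (@supported n (k - 2) `<=` length_ball (L_ n) r)%classic.
  move=> m /L_le /= /le_trans; apply; case: k kmin {Pk ball2} => [|[|k]] kmin.
  - by rewrite expr0 subrr mulr0.
  - by rewrite expr0 subrr mulr0.
  have : 2 * n%:R ^+ k.+1 <= r.
    by rewrite leNgt; apply/negP => /kmin; rewrite ltnn.
  have n2 : 2 <= n%:R :> R by rewrite ler_nat.
  have nk : 0 <= n%:R ^+ k :> R by rewrite exprn_ge0.
  by rewrite !subSS subn0 exprS; nra.
have fin1 : finite_set (length_ball (@L_ R n) r) by exact: L_proper.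
have fin2 : finite_set (length_ball (@L_ R n) (2 * r)).
  by apply: L_proper; rewrite mulr_ge0.
rewrite (@leq_trans (n ^ k))//.
  rewrite -card_supported// fsubset_leq_card// -fset_set_sub//.
  exact: supported_finite.
(* Only an inequality: k - 2 is truncated to 0 when k < 2. *)
rewrite (@leq_trans (n ^ 2 * n ^ (k - 2)))//.
  by rewrite -expnD leq_exp2l// -leq_subLR.
rewrite leq_mul2l -[X in (X <= _)%N]card_supported//.
by rewrite fsubset_leq_card ?orbT// -fset_set_sub//; exact: supported_finite.
Qed.

End Length.

Theorem corollary6p3 (R : realType) (n : nat) (hn : (1 < n)%N) :
  bounded_doubling (L_ n) ((n%:R : R) `^ (4 * (1 + ln 2 / ln n%:R))).
Proof.
split; [exact: L_length|exact: L_proper|move=> r r1].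
have r0 : 0 <= r by exact: le_trans r1.
have := L_doubling hn r0; rewrite -(ler_nat R) natrM => /le_trans; apply.
(* Since log_n 2 >= 0, the exponent is at least 4, so n^2 is below the stated constant. *)
rewrite ler_wpM2r// natrX -powR_mulrn// ler_powR ?ler1n 1?ltnW//.
have : 0 <= ln 2 / ln n%:R :> R by rewrite divr_ge0// ln_ge0// ler1n// ltnW.
lra.
Qed.
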